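(* Let $K$ be a totally real number field with $\sqrt{2}\notin K$ which contains a nonsquare totally positive unit $\varepsilon$ (that is, a totally positive unit of $\mathcal{O}_K$ which is not a square in $K$) such that $2\varepsilon$ is not a square in $K$. Then there is no universal classical totally positive definite ternary quadratic form over $\mathcal{O}_K$.
   Context: $\mathcal{O}_K$ is the ring of algebraic integers of $K$. An element $\alpha\in K$ is totally positive ($\alpha\succ 0$) if $\sigma(\alpha)>0$ for every embedding $\sigma$ of $K$ into $\mathbb{C}$ (these all have image in $\mathbb{R}$ since $K$ is totally real); $\mathcal{O}_K^+$ is the set of totally positive elements of $\mathcal{O}_K$. An $n$-ary quadratic form over $\mathcal{O}_K$ is $Q(x_1,\dots,x_n)=\sum_{1\le i\le j\le n}a_{ij}x_ix_j$ with $a_{ij}\in\mathcal{O}_K$; it is ternary if $n=3$; classical if $2$ divides $a_{ij}$ in $\mathcal{O}_K$ for all $i\ne j$; totally positive definite if $Q(\mathbf{x})\succ 0$ for all nonzero $\mathbf{x}\in\mathcal{O}_K^n$; universal if for every $\alpha\in\mathcal{O}_K^+$ there is $\mathbf{e}\in\mathcal{O}_K^n$ with $Q(\mathbf{e})=\alpha$. *)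

(* Defs.v *)
From HB Require Import structures.
From mathcomp Require Import all_boot all_order all_algebra all_field.
From mathcomp Require Import reals complex.

Set Implicit Arguments.
Unset Strict Implicit.
Unset Printing Implicit Defensive.

Import Order.TTheory GRing.Theory Num.Theory.

Local Open Scope ring_scope.

(* A number field is a [K : fieldExtType rat]; for [R : realType], the field
   of complex numbers is [R[i]].  The order on [R[i]] is partial:
   [0 < z] means that z is real and positive. *)

Definition is_algint (K : fieldExtType rat) (x : K) : Prop :=
  integralOver (intr : int -> K) x.

Definition totally_real (R : realType) (K : fieldExtType rat) : Prop :=
  forall (sigma : {rmorphism K -> R[i]}) (x : K), sigma x \is Num.real.

Definition totally_positive (R : realType) (K : fieldExtType rat) (x : K) :
    Prop :=
  forall sigma : {rmorphism K -> R[i]}, 0 < sigma x.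

Definition is_algint_unit (K : fieldExtType rat) (x : K) : Prop :=
  is_algint x /\ exists2 y : K, is_algint y & x * y = 1.

Definition is_square (K : fieldExtType rat) (x : K) : Prop :=
  exists y : K, y ^+ 2 = x.

Definition algint_vec (K : fieldExtType rat) (n : nat) (x : 'rV[K]_n) : Prop :=
  forall i : 'I_n, is_algint (x 0 i).

(* A quadratic form is given by its coefficients a_ij with i <= j; the entries
   of [a] below the diagonal are never used. *)
Definition qform_eval (K : fieldExtType rat) (n : nat) (a : 'M[K]_n)
    (x : 'rV[K]_n) : K :=
  \sum_(i < n) \sum_(j < n | (i <= j)%N) a i j * x 0 i * x 0 j.

Definition algint_qform (K : fieldExtType rat) (n : nat) (a : 'M[K]_n) : Prop :=
  forall i j : 'I_n, (i <= j)%N -> is_algint (a i j).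

Definition classical_qform (K : fieldExtType rat) (n : nat) (a : 'M[K]_n) :
    Prop :=
  forall i j : 'I_n, (i < j)%N -> exists2 b : K, is_algint b & a i j = 2 * b.

Definition totally_posdef_qform (R : realType) (K : fieldExtType rat)
    (n : nat) (a : 'M[K]_n) : Prop :=
  forall x : 'rV[K]_n, algint_vec x -> x != 0 ->
    totally_positive R (qform_eval a x).

Definition universal_qform (R : realType) (K : fieldExtType rat)
    (n : nat) (a : 'M[K]_n) : Prop :=
  forall alpha : K, is_algint alpha -> totally_positive R alpha ->
    exists2 e : 'rV[K]_n, algint_vec e & qform_eval a e = alpha.

(* Main.v *)
Require Import Defs.
From HB Require Import structures.
From mathcomp Require Import all_boot all_order all_algebra all_field.
From mathcomp Require Import reals complex.
From mathcomp Require Import mxred spectral ring.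

Set Implicit Arguments.
Unset Strict Implicit.
Unset Printing Implicit Defensive.

Import Order.TTheory GRing.Theory Num.Theory.
Import VectorInternalTheory.

Local Open Scope ring_scope.

(** A universal form must represent 1 and eps.  Both are units, so the vectors
    representing them split off orthogonally, inside the lattice of integral
    vectors, because a classical form has an integral Gram matrix; the form
    becomes <1> + <eps> + L with L of rank one.  The vector for eps can be taken
    orthogonal to the vector for 1 because a totally positive unit is not a sum
    of two totally positive integers ([unit_indecomposable]) and eps is not a
    square.

    Next, twice a totally positive unit u is such a sum only as u + u
    ([twice_unit_decompose]).  As 2, eps and 2 eps are not squares, representing
    2 forces L to represent 1 or 2, and representing 2 eps forces L to represent
    eps or 2 eps ([complement_value]).  Two values of a form of rank one differ
    by a square factor of K, so eps or 2 eps is a square: a contradiction.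

    Both statements on sums follow from one fact ([algint_conj_le1_eq1]): an
    algebraic integer g all of whose conjugates lie in the interval from 0
    (excluded) to 1 equals 1.  Indeed its norm is a nonzero integer and the
    product of these conjugates, so every conjugate is 1.  If u = a + b, this
    is applied to a / u; if 2 u = a + b, to (a / u) (b / u), which equals
    1 - (a / u - 1)^2.

    The norm is obtained as the determinant of multiplication by g on K.  Over
    an algebraically closed field the commuting matrices of these
    multiplications are triangular in a common basis, and each diagonal
    position is then a field embedding of K: this yields the product formula
    [det_regular_mx_embeddings] without extending embeddings from subfields. *)

(** * The norm as a product over embeddings *)

Lemma trig_mulmx_diag (F : fieldType) (n : nat) (A B : 'M[F]_n) (i : 'I_n) :
  is_trig_mx A -> is_trig_mx B -> (A *m B) i i = A i i * B i i.
Proof.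
move=> /is_trig_mxP trA /is_trig_mxP trB.
rewrite mxE (bigD1 i) //= big1 ?addr0 // => j; rewrite neq_ltn => /orP[ji|ij].
  by rewrite (trB _ _ ji) mulr0.
by rewrite (trA _ _ ij) mul0r.
Qed.

Section RegularRepresentation.
Variable K : fieldExtType rat.
Local Notation d := (dim K).

Definition regular_mx (x : K) : 'M[rat]_d :=
  lin1_mx (v2r \o (x \*o r2v)).

Lemma mul_rV_regular (u : 'rV_d) (x : K) : u *m regular_mx x = v2r (x * r2v u).
Proof. by rewrite mul_rV_lin1. Qed.

Lemma regular_mxD : {morph regular_mx : x y / x + y}.
Proof.
by move=> x y; apply/row_matrixP=> i; rewrite !rowE mulmxDr !mul_rV_regular
  mulrDl linearD.
Qed.

Lemma regular_mxZ (a : rat) (x : K) : regular_mx (a *: x) = a *: regular_mx x.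
Proof.
by apply/row_matrixP=> i; rewrite !rowE -scalemxAr !mul_rV_regular
  -scalerAl linearZ.
Qed.

Lemma regular_mxM (x y : K) : regular_mx (x * y) = regular_mx x *m regular_mx y.
Proof.
by apply/row_matrixP=> i; rewrite mulrC !rowE mulmxA !mul_rV_regular v2rK mulrA.
Qed.

Lemma regular_mx1 : regular_mx 1 = 1%:M.
Proof.
by apply/row_matrixP=> i; rewrite !rowE mul_rV_regular mul1r r2vK mulmx1.
Qed.

Lemma det_regular_mx_neq0 (x : K) : x != 0 -> \det (regular_mx x) != 0.
Proof.
move=> x0; have /(congr1 determinant) := regular_mxM x x^-1.
rewrite divff // regular_mx1 det1 det_mulmx; apply: contra_eq_neq => ->.
by rewrite mul0r oner_neq0.
Qed.

Variable C : numClosedFieldType.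

(** The embeddings are the diagonal entries of the simultaneously triangularized
    regular representation: on triangular matrices, taking a fixed diagonal
    entry is multiplicative.  An embedding might a priori be listed twice, which
    is harmless for the product formula. *)
Lemma det_regular_mx_embeddings :
  exists s : 'I_d -> {rmorphism K -> C},
    forall x, ratr (\det (regular_mx x)) = \prod_i s i x.
Proof.
pose M x : 'M[C]_d := map_mx ratr (regular_mx x).
have MD : {morph M : x y / x + y}.
  by move=> x y; rewrite /M regular_mxD map_mxD.
have MZ a x : M (a *: x) = ratr a *: M x by rewrite /M regular_mxZ map_mxZ.
have MM x y : M (x * y) = M x *m M y by rewrite /M regular_mxM map_mxM.
have M1 : M 1 = 1%:M by rewrite /M regular_mx1 map_mx1.
have [|P /unitarymx_unit Pu /allP /= trigP] :=
  @cotrigonalization C d [seq M (r2v 'e_i) | i : 'I_d].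
  by move=> _ _ /imageP[i _ ->] /imageP[j _ ->]; rewrite /comm_mx -!MM mulrC.
pose T x := P *m M x *m invmx P.
have TD : {morph T : x y / x + y} by move=> x y; rewrite /T MD mulmxDr mulmxDl.
have TM x y : T (x * y) = T x *m T y by rewrite /T MM !mulmxA mulmxKV.
have T1 : T 1 = 1%:M by rewrite /T M1 mulmx1 mulmxV.
have TZ a x : T (a *: x) = ratr a *: T x.
  by rewrite /T MZ -scalemxAr -scalemxAl.
have T0 : T 0 = 0 by rewrite -(scale0r 0) TZ rmorph0 scale0r.
(* Only the images of a basis were triangularized; linearity does the rest. *)
have trigT x : is_trig_mx (T x).
  rewrite -(v2rK x) (row_sum_delta (v2r x)) linear_sum /=.
  elim/big_ind: _ => [|y z /is_trig_mxP Ty /is_trig_mxP Tz|i _].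
  - by rewrite T0 mx0_is_trig.
  - by apply/is_trig_mxP => i j ij; rewrite TD mxE Ty ?Tz ?addr0.
  rewrite linearZ TZ /=.
  have /is_trig_mxP Ti : is_trig_mx (T (r2v 'e_i)).
    by rewrite /T -conjumx //; apply: trigP; apply/imageP; exists i.
  by apply/is_trig_mxP => k l kl; rewrite mxE Ti ?mulr0.
have TN x : T (- x) = - T x by apply/eqP; rewrite -addr_eq0 -TD addNr T0.
have embedding i : exists s : {rmorphism K -> C}, forall x, s x = T x i i.
  pose f x := T x i i.
  have fB : zmod_morphism f by move=> x y; rewrite /f TD TN !mxE.
  have fM : monoid_morphism f.
    split=> [|x y]; first by rewrite /f T1 mxE eqxx.
    by rewrite /f TM trig_mulmx_diag.
  pose fA := GRing.isZmodMorphism.Build K C f fB.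
  pose fB' := GRing.isMonoidMorphism.Build K C f fM.
  pose g : {rmorphism K -> C} := HB.pack f fA fB'.
  by exists g.
have [s sT] := fin_all_exists embedding.
exists s => x; rewrite -det_map_mx -/(M x).
under eq_bigr do rewrite sT.
rewrite -det_trig // /T !det_mulmx mulrC mulrA -det_mulmx mulVmx //.
by rewrite det1 mul1r.
Qed.
End RegularRepresentation.

(** * Algebraic integers with small conjugates *)

Lemma rat_integral_is_int (F : numFieldType) (r : rat) :
  integralOver (intr : int -> F) (ratr r) -> r \is a Num.int.
Proof.
case=> p p_monic.
rewrite (eq_map_poly (fun m => esym (ratr_int F m))) map_poly_comp fmorph_root.
move=> r_root.
have: (ratr r : algC) \is a Num.int.
  apply: Cint_rat_Aint; first exact: Crat_rat.
  apply: (@root_monic_Aint (map_poly ratr (map_poly intr p))).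
  - by rewrite fmorph_root.
  - by rewrite map_monic monic_map.
  - by apply/polyOverP=> i; rewrite !coef_map /= ratr_int rpred_int.
case/intrP=> m; rewrite -(ratr_int algC) => /fmorph_inj ->.
exact: rpred_int.
Qed.

Section Conjugates.
Variables (R : realType) (K : fieldExtType rat).

Lemma algint_map (C : numFieldType) (s : {rmorphism K -> C}) (x : K) :
  is_algint x -> integralOver (intr : int -> C) (s x).
Proof.
case=> p p_monic; exists p => //.
rewrite (_ : map_poly _ p = map_poly s (map_poly intr p)) ?fmorph_root //.
by rewrite -map_poly_comp; apply: eq_map_poly => m /=; rewrite rmorph_int.
Qed.

(** The norm of [g] is a nonzero integer, hence at least 1, and it is a product
    of factors at most 1; so every factor is 1.  One embedding with value 1 is
    enough, since embeddings are injective. *)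
Lemma algint_conj_le1_eq1 (g : K) :
  is_algint g -> totally_positive R g ->
  (forall s : {rmorphism K -> R[i]}, s g <= 1) -> g = 1.
Proof.
move=> g_int g_pos g_le1.
have [s detE] := @det_regular_mx_embeddings K R[i].
have d_gt0 : (0 < dim K)%N by rewrite -dimvf adim_gt0.
have g_neq0 : g != 0.
  by apply: contraTneq (g_pos (s (Ordinal d_gt0))) => ->; rewrite rmorph0 ltxx.
have det_int : \det (regular_mx g) \is a Num.int.
  apply: (@rat_integral_is_int R[i]); rewrite detE.
  elim/big_ind: _ => [|x y|i _]; first exact: integral1.
    exact: integral_mul.
  exact: algint_map.
have det_ge1 : 1 <= \prod_i s i g.
  rewrite -[leRHS]ger0_norm ?prodr_ge0 // => [|i _]; last exact/ltW/g_pos.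
  have := det_regular_mx_neq0 g_neq0; have /intrP[m detm] := det_int.
  rewrite -detE detm ratr_int intr_eq0 -intr_norm ler1z => m_neq0.
  by rewrite -gtz0_ge1 normr_gt0.
have s0g : s (Ordinal d_gt0) g = 1.
  apply/le_anti; rewrite g_le1 (le_trans det_ge1) //.
  rewrite (bigD1 (Ordinal d_gt0)) //= ler_piMr ?(ltW (g_pos _)) //.
  by apply: prodr_ile1 => i _; rewrite g_le1 ltW ?g_pos.
by apply: (fmorph_inj (s (Ordinal d_gt0))); rewrite s0g rmorph1.
Qed.

(** * Sums of totally positive integers equal to a unit or to twice a unit *)

Lemma totally_positiveM (x y : K) :
  totally_positive R x -> totally_positive R y -> totally_positive R (x * y).
Proof. by move=> x_pos y_pos s; rewrite rmorphM mulr_gt0. Qed.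

Lemma totally_positiveD (x y : K) :
  totally_positive R x -> totally_positive R y -> totally_positive R (x + y).
Proof. by move=> x_pos y_pos s; rewrite rmorphD addr_gt0. Qed.

Lemma totally_positiveV (x : K) :
  totally_positive R x -> totally_positive R x^-1.
Proof. by move=> x_pos s; rewrite fmorphV invr_gt0. Qed.

Definition zero_or_positive (x : K) := x = 0 \/ totally_positive R x.

Lemma zero_or_positive_sqr (K_real : totally_real R K) (x : K) :
  zero_or_positive (x ^+ 2).
Proof.
have [->|x_neq0] := eqVneq x 0; first by left; rewrite expr0n.
right=> s; rewrite rmorphXn lt_neqAle real_exprn_even_ge0 ?K_real // andbT.
by rewrite eq_sym expf_neq0 ?fmorph_eq0.
Qed.

Lemma zero_or_positiveM (x y : K) :
  zero_or_positive x -> zero_or_positive y -> zero_or_positive (x * y).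
Proof.
move=> [-> _|x_pos [->|y_pos]]; [left; exact: mul0r|left; exact: mulr0|].
by right; apply: totally_positiveM.
Qed.

Lemma zero_or_positiveD (x y : K) :
  zero_or_positive x -> zero_or_positive y -> zero_or_positive (x + y).
Proof.
move=> [->|x_pos] [->|y_pos]; rewrite ?add0r ?addr0; [by left|by right..|].
by right; apply: totally_positiveD.
Qed.

Lemma algint_unit_inv (u : K) : is_algint_unit u -> u != 0 /\ is_algint u^-1.
Proof.
case=> _ [v v_int uv1]; have u_neq0 : u != 0.
  by apply: contra_eq_neq uv1 => ->; rewrite mul0r eq_sym oner_neq0.
by split; rewrite // -[u^-1]mulr1 -uv1 mulKf.
Qed.

(** If both summands were totally positive, all conjugates of [a / u] would lie
    strictly between 0 and 1. *)
Lemma unit_indecomposable (u a b : K) :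
  is_algint_unit u -> totally_positive R u -> is_algint a ->
  zero_or_positive a -> zero_or_positive b -> u = a + b -> a = 0 \/ b = 0.
Proof.
move=> u_unit u_pos a_int [->|a_pos]; first by left.
move=> [->|b_pos] u_eq; first by right.
right; have [u_neq0 ui_int] := algint_unit_inv u_unit.
have: a / u = 1.
  apply: algint_conj_le1_eq1 => [||s].
  - exact: integral_mul.
  - exact/totally_positiveM/totally_positiveV.
  rewrite rmorphM fmorphV ler_pdivrMr ?u_pos // mul1r u_eq rmorphD lerDl.
  exact/ltW/b_pos.
by move/divr1_eq => au; move: u_eq; rewrite au -{1}[u]addr0 => /addrI.
Qed.

(** The quotients [a / u] and [b / u] have sum 2, so by the arithmetic-geometric
    inequality the conjugates of their product are at most 1; the product is
    then 1, which is the equality case. *)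
Lemma twice_unit_decompose (K_real : totally_real R K) (u a b : K) :
  is_algint_unit u -> totally_positive R u -> is_algint a -> is_algint b ->
  zero_or_positive a -> zero_or_positive b -> 2 * u = a + b ->
  [\/ a = 0, b = 0 | a = u /\ b = u].
Proof.
move=> u_unit u_pos a_int b_int [->|a_pos]; first by constructor 1.
move=> [->|b_pos] u_eq; first by constructor 2.
constructor 3; have [u_neq0 ui_int] := algint_unit_inv u_unit.
have b_eq : b = 2 * u - a by rewrite u_eq addrC addKr.
have ab_eq : a / u * (b / u) = 1 - (a / u - 1) ^+ 2.
  by rewrite b_eq; field.
have: a / u * (b / u) = 1.
  apply: algint_conj_le1_eq1 => [||s].
  - by apply: integral_mul; apply: integral_mul.
  - by do 2!apply: totally_positiveM => //; apply: totally_positiveV.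
  rewrite ab_eq rmorphB rmorph1 gerBl rmorphXn real_exprn_even_ge0 //.
  exact: K_real.
move=> ab1; move: ab_eq; rewrite ab1 -{1}[1]subr0 => /addrI/oppr_inj/esym/eqP.
rewrite sqrf_eq0 subr_eq0 => /eqP/divr1_eq au.
by split=> //; rewrite b_eq au; ring.
Qed.
End Conjugates.

(** The first two terms of a form [<u> + <v> + L] can contribute only 0 or [u] to
    [2 * u], since any other contribution turns 2, [u * v] or [2 * u * v] into a
    square; [L] must contribute the rest [q].  This serves once with [u = 1] and
    [v = eps], once with [u = eps] and [v = 1]. *)
Lemma complement_value (R : realType) (K : fieldExtType rat)
    (K_real : totally_real R K) (u v s t q : K) :
  is_algint_unit u -> totally_positive R u ->
  is_algint v -> totally_positive R v ->
  ~ is_square (2 : K) -> ~ is_square (u * v) -> ~ is_square (2 * (u * v)) ->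
  is_algint s -> is_algint t -> is_algint q -> zero_or_positive R q ->
  2 * u = u * s ^+ 2 + (v * t ^+ 2 + q) -> q = u \/ q = 2 * u.
Proof.
move=> u_unit u_pos v_int v_pos nsq2 nsq_uv nsq_2uv s_int t_int q_int q_zp.
have u_int : is_algint u by case: u_unit.
have us_int : is_algint (u * s ^+ 2) by do 2!apply: integral_mul => //.
have vt_int : is_algint (v * t ^+ 2) by do 2!apply: integral_mul => //.
have us_zp : zero_or_positive R (u * s ^+ 2).
  by apply: zero_or_positiveM; [right | apply: zero_or_positive_sqr].
have vt_zp : zero_or_positive R (v * t ^+ 2).
  by apply: zero_or_positiveM; [right | apply: zero_or_positive_sqr].
have vt_neq_u : v * t ^+ 2 <> u.
  by move=> vt_eq; apply: nsq_uv; exists (v * t); rewrite -vt_eq; ring.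
have vt_neq_2u : v * t ^+ 2 <> 2 * u.
  by move=> vt_eq; apply: nsq_2uv; exists (v * t); rewrite mulrA -vt_eq; ring.
move=> eq_2u; have [u_neq0 _] := algint_unit_inv u_unit.
have [||us0|vtq0|[_ vtq_u]] :=
  twice_unit_decompose K_real u_unit u_pos us_int _ us_zp _ eq_2u.
- exact: integral_add.
- exact: zero_or_positiveD.
- move: eq_2u; rewrite us0 add0r => eq_2u.
  have [vt0|q0|[]//] :=
    twice_unit_decompose K_real u_unit u_pos vt_int q_int vt_zp q_zp eq_2u.
    by right; rewrite eq_2u vt0 add0r.
  by case: vt_neq_2u; rewrite eq_2u q0 addr0.
- case: nsq2; exists s; apply: (mulfI u_neq0).
  by rewrite [RHS]mulrC eq_2u vtq0 addr0.
have [vt0|q0] :=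
  unit_indecomposable u_unit u_pos vt_int vt_zp q_zp (esym vtq_u).
  by left; rewrite -vtq_u vt0 add0r.
by case: vt_neq_u; rewrite -[RHS]vtq_u q0 addr0.
Qed.

(** * Symmetric bilinear forms and Gram matrices *)

Section BilinearForm.
Variables (F : fieldType) (n : nat) (S : 'M[F]_n).

Definition bform (x y : 'rV[F]_n) : F := (x *m S *m y^T) 0 0.

Lemma bformDl (x y z : 'rV_n) : bform (x + y) z = bform x z + bform y z.
Proof. by rewrite /bform !mulmxDl mxE. Qed.

Lemma bformZl (c : F) (x z : 'rV_n) : bform (c *: x) z = c * bform x z.
Proof. by rewrite /bform -!scalemxAl mxE. Qed.

Hypothesis S_sym : S^T = S.

Lemma bformC (x y : 'rV_n) : bform x y = bform y x.
Proof.
have xyT : (x *m S *m y^T)^T = y *m S *m x^T.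
  by rewrite !trmx_mul trmxK S_sym mulmxA.
by rewrite /bform -xyT [RHS]mxE.
Qed.

Lemma bform_sqrD (x y : 'rV_n) :
  bform x y = 0 -> bform (x + y) (x + y) = bform x x + bform y y.
Proof.
move=> xy0; rewrite bformDl bformC bformDl [bform y (x + y)]bformC bformDl.
by rewrite xy0 [bform y x]bformC xy0 addr0 add0r.
Qed.

(** An orthogonal family of [n] nonisotropic vectors has an invertible Gram
    matrix [E *m S *m E^T], hence [S *m E^T] is invertible and kills no [y]. *)
Lemma orthogonal_to_basis_eq0 (e : 'I_n -> 'rV[F]_n) (y : 'rV_n) :
  (forall i, bform (e i) (e i) != 0) ->
  (forall i j, i != j -> bform (e i) (e j) = 0) ->
  (forall i, bform y (e i) = 0) -> y = 0.
Proof.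
move=> e_neq0 e_orth y_orth; pose E := \matrix_i e i.
have prodE m (A : 'M_(m, n)) i j : (A *m S *m E^T) i j = bform (row i A) (e j).
  by rewrite /bform -row_mul !mxE; apply: eq_bigr => k _; rewrite !mxE.
have gramE : E *m S *m E^T = diag_mx (\row_i bform (e i) (e i)).
  apply/matrixP => i j; rewrite prodE rowK !mxE.
  by case: eqVneq => [->|/e_orth].
have SE_unit : S *m E^T \in unitmx.
  have : E *m (S *m E^T) \in unitmx.
    rewrite mulmxA gramE unitmxE det_diag unitfE; apply/prodf_neq0 => i _.
    by rewrite mxE.
  by rewrite unitmx_mul => /andP[].
apply: (can_inj (mulmxK SE_unit)); rewrite mul0mx mulmxA.
by apply/rowP=> j; rewrite prodE row_id y_orth mxE.
Qed.
End BilinearForm.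

(** [U] is the upper triangular matrix of the form, so the symmetrized matrix
    has half of [a i j] off the diagonal: its integrality is what being
    classical means. *)
Definition gram_mx (K : fieldExtType rat) (n : nat) (a : 'M[K]_n) : 'M[K]_n :=
  let U := \matrix_(i, j) (if (i <= j)%N then a i j else 0) in
  2^-1 *: (U + U^T).

Lemma fieldext_rat_2_neq0 (K : fieldExtType rat) : 2 != 0 :> K.
Proof. by rewrite -[2](@scaler_nat rat K 2 1) scaler_eq0 oner_eq0. Qed.

Section GramMatrix.
Variables (K : fieldExtType rat) (n : nat) (a : 'M[K]_n).

Let two_neq0 := fieldext_rat_2_neq0 K.

Lemma gram_mx_sym : (gram_mx a)^T = gram_mx a.
Proof. by rewrite linearZ linearD /= trmxK addrC. Qed.

Lemma qform_evalE (x : 'rV_n) : qform_eval a x = bform (gram_mx a) x x.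
Proof.
rewrite /bform /gram_mx; set U := \matrix_(i, j) _.
have xUx : (x *m U *m x^T) 0 0 = qform_eval a x.
  rewrite /qform_eval mxE.
  under eq_bigr => j _ do rewrite mxE mulr_suml.
  rewrite exchange_big; apply: eq_bigr => i _.
  rewrite [RHS]big_mkcond; apply: eq_bigr => j _; rewrite !mxE /=.
  by case: ifP => _; rewrite ?mulr0 ?mul0r // [a i j * _]mulrC.
have xUTx : x *m U^T *m x^T = (x *m U *m x^T)^T.
  by rewrite !trmx_mul trmxK mulmxA.
rewrite -scalemxAr -scalemxAl mulmxDr mulmxDl xUTx.
rewrite mxE [X in _ * X]mxE [X in _ * (_ + X)]mxE xUx.
by rewrite -mulr2n -[X in _ * X]mulr_natl mulKf.
Qed.

Lemma gram_mx_algint (i j : 'I_n) :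
  algint_qform a -> classical_qform a -> is_algint (gram_mx a i j).
Proof.
move=> a_int a_classical; rewrite !mxE.
case: ltngtP => [ij|ji|/val_inj ->].
- by have [b b_int ->] := a_classical _ _ ij; rewrite addr0 mulKf.
- by have [b b_int ->] := a_classical _ _ ji; rewrite add0r mulKf.
by rewrite -mulr2n -[X in _ * X]mulr_natl mulKf //; apply: a_int.
Qed.

End GramMatrix.

Lemma bform_algint (K : fieldExtType rat) (n : nat) (S : 'M[K]_n)
    (x y : 'rV[K]_n) :
  (forall i j, is_algint (S i j)) -> algint_vec x -> algint_vec y ->
  is_algint (bform S x y).
Proof.
move=> S_int x_int y_int.
have sum_int (f : 'I_n -> K) :
    (forall i, is_algint (f i)) -> is_algint (\sum_i f i).
  move=> f_int; elim/big_ind: _ => [|b c|i _]; first exact: integral0.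
    exact: integral_add.
  exact: f_int.
rewrite /bform mxE; apply: (sum_int) => j; rewrite [_^T _ _]mxE mxE.
apply: integral_mul; last exact: y_int.
apply: (sum_int (fun i => x 0 i * S i j)) => i.
by apply: integral_mul; [apply: x_int | apply: S_int].
Qed.

(** Orthogonal projection along [e] stays integral because the value of the form
    at [e] is a unit. *)
Lemma split_unit_vector (K : fieldExtType rat) (n : nat) (S : 'M[K]_n)
    (e x : 'rV[K]_n) :
  S^T = S -> (forall i j, is_algint (S i j)) ->
  algint_vec e -> is_algint_unit (bform S e e) -> algint_vec x ->
  exists t w, [/\ is_algint t, algint_vec w, x = t *: e + w, bform S w e = 0
    & bform S x x = bform S e e * t ^+ 2 + bform S w w].
Proof.
move=> S_sym S_int e_int ee_unit x_int.
have [ee_neq0 eei_int] := algint_unit_inv ee_unit.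
pose t := bform S x e / bform S e e; pose w := x - t *: e.
have x_eq : x = t *: e + w by rewrite addrC subrK.
have t_int : is_algint t by apply: integral_mul => //; apply: bform_algint.
have we0 : bform S w e = 0.
  by rewrite bformDl -scaleNr bformZl mulNr divfK // subrr.
exists t, w; split=> // [i|].
  rewrite !mxE; apply: integral_sub; first exact: x_int.
  by apply: integral_mul => //; apply: e_int.
rewrite {1 2}x_eq bform_sqrD //; last by rewrite bformZl bformC // we0 mulr0.
by rewrite bformZl [bform S e _]bformC // bformZl; ring.
Qed.

(** * Ternary forms *)

Theorem theorem1p2 (R : realType) (K : fieldExtType rat)
    (K_real : totally_real R K)
    (sqrt2_notin : ~ is_square (2 : K))
    (has_unit : exists eps : K,
       [/\ is_algint_unit eps, totally_positive R eps,
           ~ is_square eps & ~ is_square (2 * eps)]) :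
  ~ exists a : 'M[K]_3,
      [/\ algint_qform a, classical_qform a,
          totally_posdef_qform R a & universal_qform R a].
Proof.
case: has_unit => eps [eps_unit eps_pos nsq_eps nsq_2eps].
case=> a [a_int a_classical a_pos a_univ].
have S_sym := gram_mx_sym a.
have S_int i j : is_algint (gram_mx a i j) by apply: gram_mx_algint.
have Q_pos x : algint_vec x -> x != 0 ->
    totally_positive R (bform (gram_mx a) x x).
  by move=> x_int x_neq0; rewrite -qform_evalE; apply: a_pos.
have Q_univ c : is_algint c -> totally_positive R c ->
    exists2 x, algint_vec x & bform (gram_mx a) x x = c.
  by move=> c_int /(a_univ _ c_int)[x x_int]; rewrite qform_evalE; exists x.
move: (gram_mx a) S_sym S_int Q_pos Q_univ => S S_sym S_int Q_pos Q_univ.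
have Q_int x : algint_vec x -> is_algint (bform S x x).
  by move=> x_int; apply: bform_algint.
have Q_zp x : algint_vec x -> zero_or_positive R (bform S x x).
  move=> x_int; have [->|x_neq0] := eqVneq x 0; last by right; apply: Q_pos.
  by left; rewrite /bform !mul0mx mxE.
have eps_int : is_algint eps by case: eps_unit.
have [eps_neq0 _] := algint_unit_inv eps_unit.
have one_int : is_algint (1 : K) by apply: integral1.
have two_int : is_algint (2 : K) by apply: integral_nat.
have one_pos : totally_positive R (1 : K) by move=> s; rewrite rmorph1.
have two_pos : totally_positive R (2 : K) by move=> s; rewrite rmorph_nat.
have one_unit : is_algint_unit (1 : K) by split=> //; exists 1; rewrite ?mulr1.
have [e1 e1_int Q_e1] := Q_univ _ one_int one_pos.
have [e2 [e2_int e21 Q_e2]] : exists e2,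
    [/\ algint_vec e2, bform S e2 e1 = 0 & bform S e2 e2 = eps].
  have [x x_int Qx] := Q_univ _ eps_int eps_pos.
  have [|t [w [t_int w_int _ we1]]] :=
    split_unit_vector S_sym S_int e1_int _ x_int.
    by rewrite Q_e1.
  rewrite Qx Q_e1 mul1r => eps_eq.
  have [|t0|w0] := unit_indecomposable eps_unit eps_pos _
    (zero_or_positive_sqr K_real t) (Q_zp _ w_int) eps_eq.
  - exact: integral_mul.
  - by exists w; split=> //; rewrite eps_eq t0 add0r.
  by case: nsq_eps; exists t; rewrite eps_eq w0 addr0.
have split12 x : algint_vec x -> exists s t w, [/\ is_algint s, is_algint t,
    algint_vec w, bform S w e1 = 0 /\ bform S w e2 = 0
    & bform S x x = 1 * s ^+ 2 + (eps * t ^+ 2 + bform S w w)].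
  move=> x_int.
  have [|s [y [s_int y_int _ ye1 ->]]] :=
    split_unit_vector S_sym S_int e1_int _ x_int.
    by rewrite Q_e1.
  have [|t [w [t_int w_int y_eq we2 ->]]] :=
    split_unit_vector S_sym S_int e2_int _ y_int.
    by rewrite Q_e2.
  exists s, t, w; rewrite Q_e1 Q_e2; split=> //; split=> //.
  by move: ye1; rewrite y_eq bformDl bformZl e21 mulr0 add0r.
have [w1 [we11 we12 Q_w1]] : exists w,
    [/\ bform S w e1 = 0, bform S w e2 = 0
      & bform S w w = 1 \/ bform S w w = 2].
  have [x x_int Qx] := Q_univ _ two_int two_pos.
  have [s [t [w [s_int t_int w_int [we1 we2] Qx_eq]]]] := split12 x x_int.
  exists w; split=> //; rewrite -[2]mulr1.
  apply: (complement_value K_real one_unit one_pos eps_int eps_pos _ _ _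
    s_int t_int); rewrite ?mul1r ?mulr1 //; [exact: Q_int|exact: Q_zp|].
  by rewrite -Qx Qx_eq mul1r.
have [w2 [we21 we22 Q_w2]] : exists w,
    [/\ bform S w e1 = 0, bform S w e2 = 0
      & bform S w w = eps \/ bform S w w = 2 * eps].
  have [||x x_int Qx] := Q_univ (2 * eps).
  - exact: integral_mul.
  - exact: totally_positiveM.
  have [s [t [w [s_int t_int w_int [we1 we2] Qx_eq]]]] := split12 x x_int.
  exists w; split=> //.
  apply: (complement_value K_real eps_unit eps_pos one_int one_pos _ _ _
    t_int s_int); rewrite ?mulr1 //; [exact: Q_int|exact: Q_zp|].
  by rewrite -Qx Qx_eq addrCA.
have Q_w1_neq0 : bform S w1 w1 != 0.
  by case: Q_w1 => ->; rewrite ?oner_neq0 ?fieldext_rat_2_neq0.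
pose c := bform S w2 w1 / bform S w1 w1.
(* The orthogonal complement of [e1] and [e2] is the line spanned by [w1]. *)
have w2_eq : w2 = c *: w1.
  apply/eqP; rewrite -subr_eq0; apply/eqP.
  pose e (i : 'I_3) := [:: e1; e2; w1]`_i.
  apply: (orthogonal_to_basis_eq0 (S := S) (e := e)).
  - by case=> [[|[|[|//]]] i_lt]; rewrite /e /= ?Q_e1 ?Q_e2 ?oner_neq0.
  - case=> [[|[|[|//]]] i_lt] [[|[|[|//]]] j_lt] // _; rewrite /e /= //;
      by rewrite bformC.
  case=> [[|[|[|//]]] i_lt]; rewrite /e /= bformDl -scaleNr bformZl.
  - by rewrite we21 we11 mulr0 addr0.
  - by rewrite we22 we12 mulr0 addr0.
  by rewrite mulNr divfK // subrr.
have Q_w2_eq : bform S w2 w2 = c ^+ 2 * bform S w1 w1.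
  by rewrite w2_eq bformZl bformC // bformZl; ring.
case: Q_w1 Q_w2 Q_w2_eq => [->|->] [->|->] => [eq_c|eq_c|eq_c|eq_c].
- by apply: nsq_eps; exists c; rewrite eq_c mulr1.
- by apply: nsq_2eps; exists c; rewrite eq_c mulr1.
- by apply: nsq_2eps; exists (2 * c); rewrite eq_c; ring.
apply: nsq_eps; exists c; apply: (mulfI (fieldext_rat_2_neq0 K)).
by rewrite eq_c mulrC.
Qed.
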